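(* Consider the noiseless phase retrieval problem with sampling vectors satisfying Assumption 1 (stated in the context) and the RGPS iteration with $g=0$ and parameter $t$. If $$0<t<t_{\max}=\frac{2(1-\tilde\beta^2)}{2-\tilde\beta^2}<1,$$ where $\tilde\beta$ is the constant defined in the context, and if $\operatorname{dist}(z_{\mathrm{DR}}^1,z^{\natural})=\|\tilde v^1\|$ is small enough such that $\mathcal F_0$ is the only fixed point set around $z^{\natural}$, then there is $0<\gamma<1$ such that for all $k\ge1$ $$\operatorname{dist}(x^k,x^{\natural})\le(\gamma+o(1))^{k-1}\|\tilde v^1\|,$$ where $o(1)$ denotes a quantity tending to $0$ as $\|\tilde v^1\|\to0$.
   Context: Setting. $A=[a_1,\dots,a_m]\in\mathbb{C}^{n\times m}$, $A^*$ is its conjugate transpose, $m\ge n$. $|\cdot|$, products $\circ$ and quotients of vectors are entrywise, with the convention $z_i/|z_i|=0$ if $z_i=0$. Norms are Euclidean. $b\in\mathbb{R}^m$ is the vector of measurements, $b_{\min}=\min_i b_i>0$. $x^{\natural}$ is the solution of $|A^*x|=b$, $y^{\natural}=A^*x^{\natural}$ (so $|y^{\natural}|=b$), $z^{\natural}=(x^{\natural},y^{\natural})\in\mathbb{C}^{n+m}$. For a vector $u$ and reference $u^{\natural}$, $\operatorname{dist}(u,u^{\natural})=\min_{|\alpha|=1}\|u-\alpha u^{\natural}\|$. Assumption 1. (i) $A^*$ has full column rank. (ii) The solution of the phase retrieval problem $|a_i^*x|=b_i$, $i=1,\dots,m$, is unique up to the trivial ambiguities, including translation shift, mirror flipping and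 global phase shift (multiplication by a unimodular scalar); all of these are the general case for Fourier measurements, while global phase is the only ambiguity for Gaussian measurements; the solution up to these ambiguities is denoted $x^{\natural}$. (iii) The solution of the magnitude retrieval problem: find $x\in\mathbb{C}^n$ with $\frac{a_i^*x}{|a_i^*x|}=\pm\frac{a_i^*x^{\natural}}{|a_i^*x^{\natural}|}$ for $i=1,\dots,m$ (the sign may depend on $i$), is unique up to a constant magnitude factor, i.e. its solutions are $cx^{\natural}$, $c\in\mathbb{R}\setminus\{0\}$. RGPS iteration with $g=0$. Let $\Pi_{A^*}$ be the orthogonal projection of $\mathbb{C}^{n+m}$ onto the graph $\{(x,y): A^*x=y\}$ and $\operatorname{prox}_f(y)=b\circ\frac{y}{|y|}$. Given $x^0,\lambda^0\in\mathbb{C}^n$, $y^0,\nu^0\in\mathbb{C}^m$, for $k\ge0$: $(x^{k+1/2},y^{k+1/2})=(tI+(1-t)\Pi_{A^*})(x^k-\lambda^k,y^k-\nu^k)$; $x^{k+1}=x^{k+1/2}+\lambda^k$, $y^{k+1}=\operatorname{prox}_f(y^{k+1/2}+\nu^k)$; $\lambda^{k+1}=\lambda^k+x^{k+1/2}-x^{k+1}$, $\nu^{k+1}=\nu^k+y^{k+1/2}-y^{k+1}$. Put $z_{\mathrm{DR}}^k=(x_{\mathrm{DR}}^k,y_{\mathrm{DR}}^k)=(\lambda^k+x^k,\nu^k+y^k)$. With $\operatorname{prox}_\phi(x,y)=(x,\operatorname{prox}_f(y))$ this sequence satisfies, for $k\ge1$, $z_{\mathrm{DR}}^{k+1}=z_{\mathrm{DR}}^k+(tI+(1-t)\Pi_{A^*})(2\operatorname{prox}_\phi(z_{\mathrm{DR}}^k)-z_{\mathrm{DR}}^k)-\operatorname{prox}_\phi(z_{\mathrm{DR}}^k)$;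 ''fixed points'' are the fixed points of this map. $\mathcal F_0=\{(\alpha x^{\natural},\alpha y^{\natural}):|\alpha|=1\}$ (its elements are fixed points). ''$\mathcal F_0$ is the only fixed point set around $z^{\natural}$'' means that, up to a global phase shift, there are no other fixed points near $z^{\natural}$. Let $(\alpha_kx^{\natural},\alpha_ky^{\natural})$ be the projection (nearest point) of $z_{\mathrm{DR}}^k$ onto $\mathcal F_0$, $|\alpha_k|=1$, and $\tilde v^k=\begin{pmatrix}\frac{\overline{\alpha_kx^{\natural}}}{|x^{\natural}|}\circ(x_{\mathrm{DR}}^k-\alpha_kx^{\natural})\\ \frac{\overline{\alpha_ky^{\natural}}}{|y^{\natural}|}\circ(y_{\mathrm{DR}}^k-\alpha_ky^{\natural})\end{pmatrix}$. The constant $\tilde\beta$. Let $I+AA^*=LL^*$ be the Cholesky decomposition, $C=(L^{-1},\,L^{-1}A)\in\mathbb{C}^{n\times(n+m)}$, $\Omega=\operatorname{diag}\big(\frac{\alpha_kx^{\natural}}{|x^{\natural}|},\frac{\alpha_ky^{\natural}}{|y^{\natural}|}\big)$, $B=C\Omega$, and let $\sigma_2$ be the second largest singular value (with multiplicity) of the real matrix $\begin{pmatrix}\operatorname{Re}(B)\\ \operatorname{Im}(B)\end{pmatrix}\in\mathbb{R}^{2n\times(n+m)}$ (it does not depend on $\alpha_k$). Let $\delta_1=\frac{1}{\sqrt{1+s_{\min}(A)^2}}$, with $s_{\min}(A)$ the smallest nonzero singular value of $A$. Then $\tilde\beta>0$ is defined by $\tilde\beta^2=\max\{\sigma_2^2+(1-\sigma_2^2)\delta_1^2,\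 \sigma_2^2\}$.
   Formalization: The bound is stated with dist(z_DR^1, z♮) in place of ‖ṽ^1‖; the equality dist(z_DR^1, z♮) = ‖ṽ^1‖ is asserted only when x♮ has no zero entry, since otherwise (convention 0/|0| = 0) the equality and the bound at k = 1 can fail. *)

(* Defs.v *)
From mathcomp Require Import all_boot all_order all_algebra.
From mathcomp Require Import all_classical all_reals all_analysis.
From mathcomp Require Export complex.

Set Implicit Arguments.
Unset Strict Implicit.
Unset Printing Implicit Defensive.

Import Order.TTheory GRing.Theory Num.Theory numFieldNormedType.Exports.

Local Open Scope classical_set_scope.
Local Open Scope ring_scope.
Local Open Scope sesquilinear_scope.

Section Vectors.
Variable R : realType.
Local Notation C := R[i].

Definition norm2 p (u : 'cV[C]_p) : R := Num.sqrt (\sum_i Normc.normc (u i 0) ^+ 2).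

(* As 0^-1 = 0 in MathComp, phase 0 = 0. *)
Definition phase (z : C) : C := z / `|z|.

(* The infimum is attained because the unit circle is compact. *)
Definition dist p (u v : 'cV[C]_p) : R :=
  inf [set norm2 (u - alpha *: v) | alpha in [set alpha : C | `|alpha| = 1]].

Definition nearest_phase p (u v : 'cV[C]_p) (alpha : C) : Prop :=
  `|alpha| = 1 /\
  forall beta : C, `|beta| = 1 ->
    norm2 (u - alpha *: v) <= norm2 (u - beta *: v).

(* Singular values in nonincreasing order, with multiplicity.  The list has as
   many entries as M has columns: if M has fewer rows than columns, the usual
   list of singular values is followed by zeros. *)
Definition singular_values p q (M : 'M[C]_(p, q)) : seq R :=
  sort >=%R [seq Num.sqrt (complex.Re (spectral_diag (M^t* *m M) 0 j))
            | j <- enum 'I_q].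

End Vectors.

Section PhaseRetrieval.
Variables (R : realType) (n m : nat).
Local Notation C := R[i].
Implicit Types (A : 'M[C]_(n, m)) (b : 'cV[R]_m) (x : 'cV[C]_n).

Definition pr_solution A b x : Prop :=
  forall i, Normc.normc ((A^t* *m x) i 0) = b i 0.

(* Signs may differ from one measurement to another. *)
Definition mr_solution A (xs x : 'cV[C]_n) : Prop :=
  forall i, phase ((A^t* *m x) i 0) = phase ((A^t* *m xs) i 0) \/
            phase ((A^t* *m x) i 0) = - phase ((A^t* *m xs) i 0).

(* Vectors obtained from x by global phase shifts, (cyclic) translations and
   mirror flippings.  The mirror image of a complex signal is conjugated, this
   being the flipping that preserves Fourier magnitudes. *)
Inductive trivial_ambiguity (x : 'cV[C]_n) : 'cV[C]_n -> Prop :=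
| ambiguity_refl : trivial_ambiguity x x
| ambiguity_phase (alpha : C) y :
    `|alpha| = 1 -> trivial_ambiguity x y -> trivial_ambiguity x (alpha *: y)
| ambiguity_shift y :
    trivial_ambiguity x y -> trivial_ambiguity x (\col_i y (ordS i) 0)
| ambiguity_flip y :
    trivial_ambiguity x y ->
    trivial_ambiguity x (\col_i (y (rev_ord i) 0)^*).

Record assumption1 A b (xs : 'cV[C]_n) : Prop := Assumption1 {
  full_column_rank : \rank (A^t*) = n;
  pr_unique : forall x, pr_solution A b x -> trivial_ambiguity xs x;
  mr_unique : forall x,
    mr_solution A xs x <-> exists c : R, c != 0 /\ x = c%:C%C *: xs
}.

(* proj_ortho acts on row vectors, hence the transpositions: the row space of
   row_mx 1%:M (A^t* )^T is {(x^T, y^T) | A^t* *m x = y}. *)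
Definition graph_proj A (z : 'cV[C]_(n + m)) : 'cV[C]_(n + m) :=
  (z^T *m proj_ortho (row_mx 1%:M (A^t*)^T))^T.

Definition relaxed_proj A (t : R) (z : 'cV[C]_(n + m)) : 'cV[C]_(n + m) :=
  t%:C%C *: z + (1 - t)%:C%C *: graph_proj A z.

Definition prox_f b (y : 'cV[C]_m) : 'cV[C]_m :=
  \col_i ((b i 0)%:C%C * phase (y i 0)).

Definition prox_phi b (z : 'cV[C]_(n + m)) : 'cV[C]_(n + m) :=
  col_mx (usubmx z) (prox_f b (dsubmx z)).

Record rgps_state := RGPSState {
  rgps_x : 'cV[C]_n;
  rgps_y : 'cV[C]_m;
  rgps_lambda : 'cV[C]_n;
  rgps_nu : 'cV[C]_m
}.

Definition rgps_step A b (t : R) (s : rgps_state) : rgps_state :=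
  let: RGPSState x y lambda nu := s in
  let half := relaxed_proj A t (col_mx (x - lambda) (y - nu)) in
  let x' := usubmx half + lambda in
  let y' := prox_f b (dsubmx half + nu) in
  RGPSState x' y' (lambda + usubmx half - x') (nu + dsubmx half - y').

Definition rgps A b (t : R) (s0 : rgps_state) (k : nat) : rgps_state :=
  iter k (rgps_step A b t) s0.

Definition z_DR (s : rgps_state) : 'cV[C]_(n + m) :=
  col_mx (rgps_lambda s + rgps_x s) (rgps_nu s + rgps_y s).

Definition DR_map A b (t : R) (z : 'cV[C]_(n + m)) : 'cV[C]_(n + m) :=
  z + relaxed_proj A t (2 *: prox_phi b z - z) - prox_phi b z.

Definition z_nat A (xs : 'cV[C]_n) : 'cV[C]_(n + m) :=
  col_mx xs (A^t* *m xs).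

Definition F0 A (xs : 'cV[C]_n) : set 'cV[C]_(n + m) :=
  [set alpha *: z_nat A xs | alpha in [set alpha : C | `|alpha| = 1]].

(* Up to a global phase, the fixed points at distance less than rho from
   z_nat are exactly z_nat. *)
Definition only_fixed_point_set A b (t : R) (xs : 'cV[C]_n) (rho : R) : Prop :=
  forall z, DR_map A b t z = z -> dist z (z_nat A xs) < rho -> F0 A xs z.

Definition v_tilde A (xs : 'cV[C]_n) (alpha : C) (z : 'cV[C]_(n + m)) :
    'cV[C]_(n + m) :=
  let zs := z_nat A xs in
  \col_i ((alpha * zs i 0)^* / `|zs i 0| * (z i 0 - alpha * zs i 0)).

Definition is_cholesky (L M : 'M[C]_n) : Prop :=
  [/\ is_trig_mx L, forall i, 0 < L i i & M = L *m L^t*].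

Definition Omega A (xs : 'cV[C]_n) (alpha : C) : 'M[C]_(n + m) :=
  diag_mx (\row_i (alpha * z_nat A xs i 0 / `|z_nat A xs i 0|)).

(* L is the Cholesky factor of 1%:M + A *m A^t*. *)
Definition B_mx A (L : 'M[C]_n) (xs : 'cV[C]_n) (alpha : C) : 'M[C]_(n, n + m) :=
  row_mx (invmx L) (invmx L *m A) *m Omega A xs alpha.

Definition re_im_mx p q (B : 'M[C]_(p, q)) : 'M[R]_(p + p, q) :=
  col_mx (map_mx (@complex.Re R) B) (map_mx (@complex.Im R) B).

(* Multiplying B by a unimodular scalar rotates the rows of re_im_mx B and
   does not change its singular values, so the phase in Omega is irrelevant
   and we take it to be 1. *)
Definition sigma2 A (L : 'M[C]_n) (xs : 'cV[C]_n) : R :=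
  (singular_values
     (map_mx (real_complex R) (re_im_mx (B_mx A L xs 1))))`_1.

Definition s_min A : R := last 0 [seq s <- singular_values A | s != 0].

Definition delta1 A : R := 1 / Num.sqrt (1 + s_min A ^+ 2).

Definition beta_tilde A (L : 'M[C]_n) (xs : 'cV[C]_n) : R :=
  let s := sigma2 A L xs in
  Num.sqrt (Num.max (s ^+ 2 + (1 - s ^+ 2) * delta1 A ^+ 2) (s ^+ 2)).

Definition t_max A (L : 'M[C]_n) (xs : 'cV[C]_n) : R :=
  2 * (1 - beta_tilde A L xs ^+ 2) / (2 - beta_tilde A L xs ^+ 2).

End PhaseRetrieval.

(* Main.v *)
Require Import Defs.
From HB Require Import structures.
From mathcomp Require Import all_boot all_order all_algebra.
From mathcomp Require Import all_classical all_reals all_analysis.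
From mathcomp Require Import ring lra.
Import Order.TTheory GRing.Theory Num.Theory numFieldNormedType.Exports.
Local Open Scope classical_set_scope.
Local Open Scope ring_scope.
Local Open Scope sesquilinear_scope.

Set Implicit Arguments.
Unset Strict Implicit.
Unset Printing Implicit Defensive.

(** The iteration contracts the Euclidean distance to the orbit of
    [zs = z_nat A xs] under global phases, up to a quadratic error; this gives
    the linear rate with constant 1.

    Write [Pi] for the orthogonal projection onto the graph of [A^t*] and [Q]
    for the real-orthogonal projection which keeps, in the [y] block, the
    component of each entry along the phase of the corresponding measurement
    ([radial] below).  To first order, moving the argument of [prox_f] along
    that phase does not move its value, so the differential of [prox_phi] at
    [zs] is [P = 1 - Q].  Substituting this in the Douglas-Rachford map shows
    that its differential at [zs] sends [v] to
    [Pi P v + (1 - Pi) (t P v + (1 - t) Q v)].  The two summands are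
    orthogonal, and convexity of the square gives
    [|S v|^2 <= |v|^2 - (1 - t) |(1 - Pi) P v|^2 - t |Q v|^2]  ([DR_lin_sqr]).

    If both defects vanish, then [v = (x, A^t* x)], and every entry of [A^t* x]
    is orthogonal to the corresponding entry of [A^t* xs].  Then
    [xs - s i x] has, for small [s > 0], the same measurement phases as [xs],
    and uniqueness in the magnitude retrieval problem forces [x] to be a real
    multiple of [i xs]  ([graph_tangent_kernel]).  This is the direction
    tangent to the orbit of [zs], and it is excluded by choosing the nearest
    point of the orbit.  An injective real-linear map in finite dimension is
    bounded below, so for [0 < t < 1] the differential contracts by a fixed
    factor [g < 1] on the orthogonal complement of [i zs]
    ([DR_lin_contraction]).

    The Taylor error of the phase map is at most quadratic, and at most linear
    for large arguments ([phase_taylor]).  Since the Douglas-Rachford map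
    commutes with global phases, the distances [d_k] to the orbit satisfy
    [d_(k+1) <= (g + K d_k) d_k] and [d_(k+1) <= (g + 2) d_k] globally, whence
    the claim by induction ([geometric_decay]).

    It remains to see that the admissible [t] are smaller than 1.  The matrix
    [(L^-1, L^-1 A)] has orthonormal rows, so [sigma2 <= 1]; together with
    [0 < delta1 <= 1] this gives [0 < beta_tilde ^+ 2 <= 1], hence
    [t_max < 1]. *)

(** * Real inner product on complex column vectors *)

Section RealInnerProduct.
Variable R : realType.
Local Notation C := R[i].
Local Notation Re := (@complex.Re R).
Local Notation Im := (@complex.Im R).
Local Notation normc := (@Normc.normc R).

(** The product of [z] and [w] as vectors of the real plane.  The iteration is
    only real-linear to first order, so orthogonality is meant over the reals
    throughout. *)
Definition cdot (z w : C) : R := Re z * Re w + Im z * Im w.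

Lemma cdotC z w : cdot z w = cdot w z.
Proof. by rewrite /cdot mulrC [Im z * _]mulrC. Qed.

Lemma cdotDr z w1 w2 : cdot z (w1 + w2) = cdot z w1 + cdot z w2.
Proof. by case: z w1 w2 => [a b] [c d] [e f]; rewrite /cdot /=; ring. Qed.

Lemma cdotZr z (r : R) w : cdot z (r%:C%C * w) = r * cdot z w.
Proof. by case: z w => [a b] [c d]; rewrite /cdot /=; ring. Qed.

Lemma cdot0r z : cdot z 0 = 0.
Proof. by rewrite /cdot /= !mulr0 addr0. Qed.

Lemma cdot_sumr (I : finType) z (F : I -> C) :
  cdot z (\sum_i F i) = \sum_i cdot z (F i).
Proof. exact: (big_morph _ (cdotDr z) (cdot0r z)). Qed.

Lemma cdot_adj a z w : cdot (a * z) w = cdot z (a^* * w).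
Proof. by case: a z w => [a b] [c d] [e f]; rewrite /cdot /=; ring. Qed.

Lemma normc_sqr z : normc z ^+ 2 = cdot z z.
Proof.
case: z => a b; rewrite /cdot /Normc.normc /= sqr_sqrtr ?addr_ge0 ?sqr_ge0//.
Qed.

Lemma normc_ge0 z : 0 <= normc z.
Proof. by case: z => a b; rewrite sqrtr_ge0. Qed.

Lemma normcE (z : C) : `|z| = (normc z)%:C%C.
Proof. by case: z. Qed.

Lemma normcM z w : normc (z * w) = normc z * normc w.
Proof. exact: Normc.normcM. Qed.

Lemma normcN z : normc (- z) = normc z.
Proof. by case: z => a b /=; rewrite !sqrrN. Qed.

Lemma normcD z w : normc (z + w) <= normc z + normc w.
Proof. exact: le_normcD. Qed.

Lemma normc_real (r : R) : normc r%:C%C = `|r|.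
Proof. by rewrite /= expr0n /= addr0 sqrtr_sqr. Qed.

Lemma normc_eq1 (z : C) : `|z| = 1 <-> normc z = 1.
Proof. by rewrite normcE; split => [/complexI//|->]. Qed.

Variable p : nat.
Implicit Types u v w : 'cV[C]_p.

Definition rdot u v : R := \sum_i cdot (u i 0) (v i 0).

Lemma rdotC u v : rdot u v = rdot v u.
Proof. by apply: eq_bigr => i _; rewrite cdotC. Qed.

Lemma rdotDr u v w : rdot u (v + w) = rdot u v + rdot u w.
Proof. by rewrite -big_split; apply: eq_bigr => i _; rewrite mxE cdotDr. Qed.

Lemma rdotDl u v w : rdot (v + w) u = rdot v u + rdot w u.
Proof. by rewrite rdotC rdotDr !(rdotC u). Qed.

Lemma rdotZr (r : R) u v : rdot u (r%:C%C *: v) = r * rdot u v.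
Proof. by rewrite mulr_sumr; apply: eq_bigr => i _; rewrite mxE cdotZr. Qed.

Lemma rdotZl (r : R) u v : rdot (r%:C%C *: u) v = r * rdot u v.
Proof. by rewrite rdotC rdotZr rdotC. Qed.

Lemma rdotNr u v : rdot u (- v) = - rdot u v.
Proof. by rewrite -mulN1r -rdotZr rmorphN1 scaleN1r. Qed.

Lemma rdotNl u v : rdot (- u) v = - rdot u v.
Proof. by rewrite rdotC rdotNr rdotC. Qed.

Lemma rdot0r u : rdot u 0 = 0.
Proof. by rewrite /rdot big1// => i _; rewrite mxE cdot0r. Qed.

Lemma rdot_unit_adj (a : C) u v : rdot (a *: u) v = rdot u (a^* *: v).
Proof. by apply: eq_bigr => i _; rewrite !mxE cdot_adj. Qed.

Lemma rdot_ge0 u : 0 <= rdot u u.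
Proof. by apply: sumr_ge0 => i _; rewrite -normc_sqr sqr_ge0. Qed.

Lemma norm2_sqr u : norm2 u ^+ 2 = rdot u u.
Proof.
rewrite sqr_sqrtr; last by apply: sumr_ge0 => i _; rewrite sqr_ge0.
by apply: eq_bigr => i _; rewrite normc_sqr.
Qed.

Lemma norm2_ge0 u : 0 <= norm2 u.
Proof. exact: sqrtr_ge0. Qed.

Lemma rdot_eq0 u : rdot u u = 0 -> u = 0.
Proof.
move=> /eqP; rewrite psumr_eq0; last by move=> i _; rewrite -normc_sqr sqr_ge0.
move=> /allP h; apply/colP => i; rewrite mxE.
have := h i (mem_index_enum i); rewrite /= -normc_sqr sqrf_eq0 => /eqP.
exact: Normc.eq0_normc.
Qed.

Lemma cauchy_schwarz_sqr u v : rdot u v ^+ 2 <= rdot u u * rdot v v.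
Proof.
have [->|v0] := eqVneq v 0; first by rewrite !rdot0r expr0n /= mulr0.
have v2 : 0 < rdot v v.
  rewrite lt_neqAle rdot_ge0 andbT eq_sym; apply: contra_neq v0; exact: rdot_eq0.
have := rdot_ge0 ((rdot v v)%:C%C *: u - (rdot u v)%:C%C *: v).
rewrite !(rdotDr, rdotDl, rdotNr, rdotNl, rdotZr, rdotZl) (rdotC v u) => h.
rewrite -subr_ge0 -(pmulr_rge0 _ v2); apply: le_trans h _.
by rewrite le_eqVlt; apply/orP; left; apply/eqP; ring.
Qed.

Lemma cauchy_schwarz u v : rdot u v <= norm2 u * norm2 v.
Proof.
apply: le_trans (ler_norm _) _.
rewrite -(ler_pXn2r (n := 2)) ?nnegrE ?mulr_ge0 ?norm2_ge0//.
by rewrite real_normK ?num_real// exprMn !norm2_sqr cauchy_schwarz_sqr.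
Qed.

Lemma norm2_triangle u v : norm2 (u + v) <= norm2 u + norm2 v.
Proof.
rewrite -(ler_pXn2r (n := 2)) ?nnegrE ?addr_ge0 ?norm2_ge0//.
rewrite sqrrD !norm2_sqr rdotDr !rdotDl (rdotC v u).
have := cauchy_schwarz u v; lra.
Qed.

Lemma norm2_leM (c : R) u v : 0 <= c ->
  (norm2 u <= c * norm2 v) = (rdot u u <= c ^+ 2 * rdot v v).
Proof.
by move=> c0; rewrite -!norm2_sqr -exprMn ler_pXn2r ?nnegrE ?mulr_ge0 ?norm2_ge0.
Qed.

(** Bounds vectors that are controlled entry by entry, such as the error of an
    entrywise map. *)
Lemma norm2_le_coord (c : R) u v : 0 <= c ->
  (forall i, normc (u i 0) <= c * normc (v i 0)) -> norm2 u <= c * norm2 v.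
Proof.
move=> c0 h; rewrite norm2_leM// mulr_sumr; apply: ler_sum => i _.
by rewrite -!normc_sqr -exprMn ler_pXn2r ?nnegrE ?mulr_ge0 ?normc_ge0.
Qed.

Lemma coord_le_norm2 u i : normc (u i 0) <= norm2 u.
Proof.
rewrite -(ler_pXn2r (n := 2)) ?nnegrE ?norm2_ge0 ?normc_ge0// norm2_sqr normc_sqr.
rewrite /rdot (bigD1 i)//= lerDl; apply: sumr_ge0 => j _.
by rewrite -normc_sqr sqr_ge0.
Qed.

Lemma norm2_unit (a : C) u : `|a| = 1 -> norm2 (a *: u) = norm2 u.
Proof.
move=> /normc_eq1 a1; congr Num.sqrt; apply: eq_bigr => i _.
by rewrite mxE normcM a1 mul1r.
Qed.

End RealInnerProduct.

Lemma norm2_le (R : realType) p q (u : 'cV[R[i]]_p) (v : 'cV[R[i]]_q) :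
  (norm2 u <= norm2 v) = (rdot u u <= rdot v v).
Proof. by rewrite -!norm2_sqr ler_pXn2r ?nnegrE ?norm2_ge0. Qed.

Lemma rdot_mulmx (R : realType) p q (M : 'M[R[i]]_(p, q)) u v :
  rdot (M *m u) v = rdot u (M^t* *m v).
Proof.
transitivity (\sum_i \sum_j cdot (M i j * u j 0) (v i 0)).
  apply: eq_bigr => i _; rewrite mxE cdotC cdot_sumr.
  by apply: eq_bigr => j _; rewrite cdotC.
rewrite exchange_big; apply: eq_bigr => j _; rewrite mxE cdot_sumr.
by apply: eq_bigr => i _; rewrite cdot_adj !mxE.
Qed.

Lemma rdot_col_mx (R : realType) p q (u1 v1 : 'cV[R[i]]_p) (u2 v2 : 'cV[R[i]]_q) :
  rdot (col_mx u1 u2) (col_mx v1 v2) = rdot u1 v1 + rdot u2 v2.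
Proof.
rewrite /rdot big_split_ord; congr (_ + _); apply: eq_bigr => i _.
  by rewrite !col_mxEu.
by rewrite !col_mxEd.
Qed.

(** * Phases and their first-order expansion *)

Section Phase.
Variable R : realType.
Local Notation C := R[i].
Local Notation normc := (@Normc.normc R).

Lemma phaseM (a z : C) : phase (a * z) = phase a * phase z.
Proof. by rewrite /phase normrM invfM mulrACA. Qed.

Lemma phase_unit (a : C) : `|a| = 1 -> phase a = a.
Proof. by rewrite /phase => ->; rewrite invr1 mulr1. Qed.

Lemma phase_pos (r : R) : 0 < r -> phase r%:C%C = 1.
Proof.
move=> r0; rewrite /phase ger0_norm ?ler0c ?(ltW r0)// divff//.
by rewrite (inj_eq (@complexI R)) gt_eqF.
Qed.

Lemma normc_phase_eq (z : C) : z = (normc z)%:C%C * phase z.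
Proof.
rewrite /phase normcE mulrCA; have [z0|z0] := eqVneq (normc z) 0.
  by rewrite (Normc.eq0_normc z0) !mul0r.
by rewrite divff ?mulr1// (inj_eq (@complexI R)).
Qed.

Lemma norm_phase (z : C) : z != 0 -> `|phase z| = 1.
Proof. by move=> z0; rewrite normrM normfV normr_id divff ?normr_eq0. Qed.

Lemma unit_conjM (a : C) : `|a| = 1 -> a^* * a = 1.
Proof. by move=> a1; rewrite mulrC -normCK a1 expr1n. Qed.

Lemma norm_conj1 (a : C) : `|a| = 1 -> `|a^*| = 1.
Proof. by rewrite norm_conjC. Qed.

(** For unimodular [w], the real-orthogonal projection of [z] onto the line
    spanned by [w]. *)
Definition radial_part (w z : C) : C := (complex.Re (w^* * z))%:C%C * w.

Lemma normc_le_parts (a c : R) : normc (Complex a c) <= `|a| + `|c|.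
Proof.
have -> : Complex a c = a%:C%C + Complex 0 c by simpc.
by apply: le_trans (normcD _ _) _; rewrite normc_real /= expr0n /= add0r sqrtr_sqr.
Qed.

(** Expansion of [b * phase] at the positive point [b], where the derivative is
    the projection onto the imaginary axis.  The linear bound holds because
    [y - b * phase y] has modulus at most [|b - |y||], and it implies the
    quadratic one as soon as [g] is not small compared with [b]; for small [g]
    the real and imaginary parts of the error are computed exactly. *)
Lemma phase_taylor_real (b : R) (g : C) : 0 < b ->
  let e := b%:C%C * phase (b%:C%C + g) - b%:C%C - (g - (complex.Re g)%:C%C) in
  normc e <= 2 * normc g /\ normc e <= 4 / b * normc g * normc g.
Proof.
move=> b0; set y := b%:C%C + g; set G := normc g; set r := normc y.
have G0 : 0 <= G by exact: normc_ge0.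
have r0 : 0 <= r by exact: normc_ge0.
have yE : y = r%:C%C * phase y by exact: normc_phase_eq.
have phle : normc (phase y) <= 1.
  have [->|y0] := eqVneq y 0; first by rewrite /phase mul0r Normc.normc0 ler01.
  by rewrite -lecR -normcE norm_phase.
have br : `|b - r| <= G.
  rewrite ler_norml; apply/andP; split.
    rewrite lerNl opprB lerBlDr; apply: le_trans (normcD _ _) _.
    by rewrite addrC normc_real gtr0_norm.
  have : normc b%:C%C <= normc y + normc (- g).
    by apply: le_trans (normcD _ _); rewrite /y addrK.
  by rewrite normcN normc_real gtr0_norm// -/r -/G; lra.
have aG : `|complex.Re g| <= G.
  by rewrite -lecR -[X in _ <= X]normcE; exact: normc_ge_Re.
have cG : `|complex.Im g| <= G.
  rewrite -(ler_pXn2r (n := 2)) ?nnegrE// real_normK ?num_real//.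
  by rewrite normc_sqr /cdot -!expr2 lerDr sqr_ge0.
move=> e.
have e2 : normc e <= 2 * G.
  have -> : e = (b - r)%:C%C * phase y + (complex.Re g)%:C%C.
    by rewrite /e rmorphB mulrBl -yE /y; ring.
  apply: le_trans (normcD _ _) _.
  rewrite normcM !normc_real.
  have : `|b - r| * normc (phase y) <= G.
    by apply: le_trans br; rewrite ler_piMr.
  lra.
split=> //.
(* For [b / 2 <= G] the linear bound is already quadratic. *)
have [Gb|Gb] := leP (b / 2) G.
  apply: (le_trans e2); apply: ler_wpM2r => //.
  by rewrite mulrAC ler_pdivlMr//; lra.
set a := complex.Re g in aG; set c := complex.Im g in cG.
have yac : y = Complex (b + a) c by rewrite /y /a /c; case: (g) => ? ?; simpc.
have gac : g = Complex a c by rewrite /a /c; case: (g).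
have ba : b / 2 < b + a by move: aG; rewrite ler_norml; lra.
have rba : b + a <= r.
  rewrite /r yac /=; apply: le_trans (ler_norm _) _.
  by rewrite -sqrtr_sqr ler_wsqrtr// lerDl sqr_ge0.
have r2 : r ^+ 2 = (b + a) ^+ 2 + c ^+ 2.
  by rewrite normc_sqr /cdot yac /= !expr2.
have rgt : b / 2 < r by lra.
have rpos : 0 < r by lra.
have rn0 : r != 0 by rewrite gt_eqF.
have -> : e = Complex (b * (b + a - r) / r) (c * (b - r) / r).
  rewrite /e; apply: (mulfI (_ : r%:C%C != 0)); first by rewrite (inj_eq (@complexI R)).
  rewrite 2!mulrBr mulrCA -yE yac gac; simpc; congr Complex; field => //.
apply: le_trans (normc_le_parts _ _) _.
have i1 : `|b * (b + a - r) / r| <= 2 / b * G * G.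
  rewrite !normrM normfV (gtr0_norm b0) (gtr0_norm rpos) ler_pdivrMr//.
  rewrite distrC ger0_norm ?subr_ge0//.
  have h : (r - (b + a)) * b <= G * G.
    have h1 : (r - (b + a)) * (r + (b + a)) = c ^+ 2 by rewrite -subr_sqr r2; ring.
    have h2 : c ^+ 2 <= G * G.
      by rewrite -real_normK ?num_real// expr2; apply: ler_pM.
    apply: le_trans h2; rewrite -h1 ler_wpM2l ?subr_ge0//; lra.
  have h3 : 2 / b * G * G * r >= G * G.
    have -> : 2 / b * G * G * r = G * G * (r * 2 / b) by ring.
    by rewrite ler_peMr ?mulr_ge0// ler_pdivlMr// mul1r; lra.
  by apply: le_trans h3; rewrite mulrC.
have i2 : `|c * (b - r) / r| <= 2 / b * G * G.
  rewrite !normrM normfV (gtr0_norm rpos).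
  have -> : 2 / b * G * G = G * G * (2 / b) by ring.
  apply: ler_pM => //; rewrite ?mulr_ge0 ?invr_ge0//; first exact: ler_pM.
  by rewrite -[2 / b]invf_div lef_pV2 ?posrE// ?divr_gt0//; lra.
have -> : 4 / b * G * G = 2 / b * G * G + 2 / b * G * G by ring.
by apply: lerD.
Qed.

(** The general expansion follows by rotating the base point onto the positive
    axis. *)
Lemma phase_taylor (b : R) (w h : C) : 0 < b -> `|w| = 1 ->
  let e := b%:C%C * phase (b%:C%C * w + h) - b%:C%C * w - (h - radial_part w h) in
  normc e <= 2 * normc h /\ normc e <= 4 / b * normc h * normc h.
Proof.
move=> b0 w1; set g := w^* * h.
have hE : h = w * g by rewrite mulrA [w * _]mulrC unit_conjM// mul1r.
have -> : normc h = normc g.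
  by rewrite hE normcM (normc_eq1 w).1 // mul1r.
move=> e; suff -> : normc e = normc (b%:C%C * phase (b%:C%C + g) - b%:C%C -
    (g - (complex.Re g)%:C%C)) by exact: phase_taylor_real.
rewrite -[RHS]mul1r -((normc_eq1 w).1 w1) -normcM; congr normc.
rewrite /e /radial_part -/g {1 2}hE [b%:C%C * w]mulrC -mulrDr phaseM phase_unit//.
ring.
Qed.

End Phase.

(** * Injective real-linear maps are bounded below *)

Section RealLinear.
Variable R : realType.
Local Notation C := R[i].

Definition realify p (u : 'cV[C]_p) : 'rV[R]_(p + p) :=
  row_mx (\row_i complex.Re (u i 0)) (\row_i complex.Im (u i 0)).

Definition complexify p (a : 'rV[R]_(p + p)) : 'cV[C]_p :=
  \col_i Complex (a 0 (lshift p i)) (a 0 (rshift p i)).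

Lemma realifyK p : cancel (@realify p) (@complexify p).
Proof.
move=> u; apply/colP => i; rewrite mxE row_mxEl row_mxEr !mxE.
by case: (u i 0).
Qed.

Lemma complexifyK p : cancel (@complexify p) (@realify p).
Proof.
by move=> a; apply/rowP => i; case: (split_ordP i) => j ->;
  rewrite ?row_mxEl ?row_mxEr !mxE.
Qed.

Lemma realify_linear p (r : R) (u v : 'cV[C]_p) :
  realify (r%:C%C *: u + v) = r *: realify u + realify v.
Proof.
rewrite /realify scale_row_mx add_row_mx.
by congr row_mx; apply/rowP => i; rewrite !mxE; case: (u i 0) (v i 0) => [? ?] [? ?];
  simpc.
Qed.

Definition sqnorm p (a : 'rV[R]_p) : R := \sum_i a 0 i ^+ 2.

Lemma sqnorm_realify p (u : 'cV[C]_p) : sqnorm (realify u) = rdot u u.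
Proof.
rewrite /sqnorm big_split_ord /= -big_split; apply: eq_bigr => i _ /=.
by rewrite row_mxEl row_mxEr !mxE /cdot !expr2.
Qed.

(** Cauchy-Schwarz in each column bounds the operator norm by the Frobenius
    norm; the row vectors are seen as complex columns to reuse the inequality. *)
Lemma sqnorm_mulmx p q (M : 'M[R]_(p, q)) :
  exists2 K, 0 <= K & forall a, sqnorm (a *m M) <= K * sqnorm a.
Proof.
exists (\sum_j \sum_i M i j ^+ 2) => [|a].
  by apply: sumr_ge0 => j _; apply: sumr_ge0 => i _; rewrite sqr_ge0.
rewrite mulr_suml; apply: ler_sum => j _; rewrite mxE.
pose u : 'cV[C]_p := \col_i (a 0 i)%:C%C.
pose v : 'cV[C]_p := \col_i (M i j)%:C%C.
have uv : \sum_i a 0 i * M i j = rdot u v.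
  by apply: eq_bigr => i _; rewrite /cdot !mxE /= mulr0 addr0.
have uu : sqnorm a = rdot u u.
  by apply: eq_bigr => i _; rewrite /cdot !mxE /= mulr0 addr0 expr2.
have vv : \sum_i M i j ^+ 2 = rdot v v.
  by apply: eq_bigr => i _; rewrite /cdot !mxE /= mulr0 addr0 expr2.
by rewrite uv uu vv mulrC cauchy_schwarz_sqr.
Qed.

(** In real coordinates the map has a row-free matrix, and such a matrix has a
    right inverse, whose operator norm provides the constant. *)
Lemma injective_bounded_below p q (f : 'cV[C]_p -> 'cV[C]_q) :
  (forall u v, f (u + v) = f u + f v) ->
  (forall (r : R) u, f (r%:C%C *: u) = r%:C%C *: f u) ->
  (forall u, f u = 0 -> u = 0) ->
  exists2 c : R, 0 < c & forall u, c * rdot u u <= rdot (f u) (f u).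
Proof.
move=> fD fZ f0.
pose g a := realify (f (complexify a)).
have glin : linear g.
  move=> r a a'; rewrite /g.
  have -> : complexify (r *: a + a') = r%:C%C *: complexify a + complexify a'.
    by apply/colP => i; rewrite !mxE; simpc.
  by rewrite fD fZ realify_linear.
pose G : {linear 'rV[R]_(p + p) -> 'rV[R]_(q + q)} :=
  HB.pack g (GRing.isLinear.Build _ _ _ _ g glin).
pose M := lin1_mx G.
have gM a : a *m M = g a by exact: mul_rV_lin1.
have Mfree : row_free M.
  rewrite -kermx_eq0; apply/rowV0P => a /sub_kermxP; rewrite gM => ga.
  have : f (complexify a) = 0.
    by rewrite -[f _]realifyK -/(g a) ga; apply/colP => i; rewrite !mxE.
  by move/f0 => a0; rewrite -[a]complexifyK a0; apply/rowP => i;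
    case: (split_ordP i) => j ->; rewrite ?row_mxEl ?row_mxEr !mxE.
have [K K0 hK] := sqnorm_mulmx (pinvmx M).
exists (K + 1)^-1 => [|u]; first by rewrite invr_gt0 ltr_wpDl.
rewrite mulrC ler_pdivrMr ?ltr_wpDl// -!sqnorm_realify.
have := hK (realify u *m M); rewrite -mulmxA mulmxVp// mulmx1 gM /g realifyK.
move=> /le_trans; apply; rewrite mulrC ler_wpM2l ?lerDl//.
by rewrite sqnorm_realify rdot_ge0.
Qed.

End RealLinear.

(** * Orthogonal projection onto the graph *)

Section GraphProjection.
Variables (R : realType) (n m : nat) (A : 'M[R[i]]_(n, m)).
Local Notation C := R[i].
Implicit Types (x : 'cV[C]_n) (z u v : 'cV[C]_(n + m)).

Lemma z_natE x : z_nat A x = col_mx 1%:M (A^t*) *m x.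
Proof. by rewrite mul_col_mx mul1mx. Qed.

Lemma z_natZ (a : C) x : z_nat A (a *: x) = a *: z_nat A x.
Proof. by rewrite !z_natE scalemxAr. Qed.

Lemma graph_projD u v : graph_proj A (u + v) = graph_proj A u + graph_proj A v.
Proof. by rewrite /graph_proj !linearD /= mulmxDl linearD. Qed.

Lemma graph_projZ (a : C) u : graph_proj A (a *: u) = a *: graph_proj A u.
Proof. by rewrite /graph_proj !linearZ /= -scalemxAl linearZ. Qed.

Lemma graph_projN u : graph_proj A (- u) = - graph_proj A u.
Proof. by rewrite -scaleN1r graph_projZ scaleN1r. Qed.

Lemma graph_proj_in u : exists x, graph_proj A u = z_nat A x.
Proof.
have /submxP [D hD] := proj_ortho_sub (row_mx 1%:M (A^t*)^T) u^T.
exists D^T; rewrite /graph_proj hD trmx_mul z_natE; congr (_ *m _).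
by rewrite tr_row_mx trmx1 trmxK.
Qed.

Lemma graph_proj_id x : graph_proj A (z_nat A x) = z_nat A x.
Proof.
rewrite /graph_proj proj_ortho_id ?trmxK//.
apply/submxP; exists x^T; rewrite z_natE trmx_mul; congr (_ *m _).
by rewrite tr_col_mx trmx1.
Qed.

Lemma graph_proj_orth u x : rdot (u - graph_proj A u) (z_nat A x) = 0.
Proof.
rewrite z_natE rdotC rdot_mulmx.
have := proj_ortho_compl_sub (row_mx 1%:M (A^t*)^T) u^T.
move=> /orthomx1P; set w := (X in X *m _) => h.
have -> : u - graph_proj A u = w^T by rewrite linearB /= trmxK.
suff -> : (col_mx 1%:M (A^t*))^t* *m w^T = 0 by rewrite rdot0r.
apply: trmx_inj; rewrite trmx_mul trmxK trmx0 -{}h; congr (_ *m _).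
have -> : row_mx 1%:M (A^t*)^T = (col_mx 1%:M (A^t*))^T :> 'M[C]_(n, n + m).
  by rewrite tr_col_mx trmx1.
by rewrite map_trmx.
Qed.

Lemma graph_proj_pyth u v :
  let w := graph_proj A u + (v - graph_proj A v) in
  rdot w w = rdot (graph_proj A u) (graph_proj A u) +
             rdot (v - graph_proj A v) (v - graph_proj A v).
Proof.
have [x hx] := graph_proj_in u; have h := graph_proj_orth v x.
move: (v - graph_proj A v) h => r h /=.
by rewrite rdotDr !rdotDl hx (rdotC (z_nat A x)) h addr0 add0r.
Qed.

Lemma rdot_graph_proj u :
  rdot u u = rdot (graph_proj A u) (graph_proj A u) +
             rdot (u - graph_proj A u) (u - graph_proj A u).
Proof.
rewrite -graph_proj_pyth.
have -> // : graph_proj A u + (u - graph_proj A u) = u.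
by rewrite addrC subrK.
Qed.

(** With [u] and [v] the tangential and radial parts of a perturbation, this is
    the differential of the Douglas-Rachford map applied to [u + v]. *)
Definition DR_lin (t : R) u v : 'cV[C]_(n + m) :=
  graph_proj A u +
  (t%:C%C *: (u - graph_proj A u) + (1 - t)%:C%C *: (v - graph_proj A v)).

(** The component in the graph is [Pi u]; the squared norm of the other one,
    a convex combination of [u - Pi u] and [v - Pi v], is at most the convex
    combination of the squared norms. *)
Lemma DR_lin_sqr (t : R) u v : 0 <= t <= 1 -> rdot u v = 0 ->
  rdot (DR_lin t u v) (DR_lin t u v) <= rdot (u + v) (u + v) -
    ((1 - t) * rdot (u - graph_proj A u) (u - graph_proj A u) + t * rdot v v).
Proof.
move=> /andP[t0 t1] uv.
have -> : DR_lin t u v = graph_proj A u +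
   ((t%:C%C *: u + (1 - t)%:C%C *: v) -
     graph_proj A (t%:C%C *: u + (1 - t)%:C%C *: v)).
  rewrite /DR_lin graph_projD !graph_projZ; congr (_ + _).
  by rewrite !scalerBr addrACA -opprD.
rewrite graph_proj_pyth graph_projD !graph_projZ.
(* The component orthogonal to the graph, as a convex combination. *)
have -> : t%:C%C *: u + (1 - t)%:C%C *: v -
   (t%:C%C *: graph_proj A u + (1 - t)%:C%C *: graph_proj A v) =
   t%:C%C *: (u - graph_proj A u) + (1 - t)%:C%C *: (v - graph_proj A v).
  by rewrite !scalerBr opprD addrACA.
have hu := rdot_graph_proj u; have hv := rdot_graph_proj v.
move: (u - graph_proj A u) (v - graph_proj A v) hu hv => u' v' hu hv.
have h1 := rdot_ge0 (graph_proj A v); have h2 := rdot_ge0 (u' - v').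
move: (rdot (graph_proj A u) _) (rdot (graph_proj A v) _) h1 hu hv => gu gv h1 hu hv.
rewrite !(rdotDr, rdotDl, rdotNr, rdotNl, rdotZr, rdotZl) in h2 *.
rewrite (rdotC v u) (rdotC v' u') uv in h2 *.
move: (rdot u' u') (rdot v' v') (rdot u' v') (rdot u u) (rdot v v) h1 h2 hu hv.
move=> a c d a' c' h1 h2 hu hv.
have s0 : 0 <= t * (1 - t) by rewrite mulr_ge0 ?subr_ge0.
have s1 : 0 <= (1 - t) * gv by rewrite mulr_ge0 ?subr_ge0.
have s2 : 0 <= t * (1 - t) * (a - d + (- d + c)).
  by apply: mulr_ge0 => //; move: h2; congr (0 <= _); ring.
rewrite -subr_ge0 hu hv; apply: le_trans (addr_ge0 s1 s2) _.
by rewrite le_eqVlt; apply/orP; left; apply/eqP; ring.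
Qed.

End GraphProjection.

(** * Phases of the measurements and the radial projection *)

Section Linearization.
Variables (R : realType) (n m : nat) (A : 'M[R[i]]_(n, m)) (b : 'cV[R]_m).
Variable xs : 'cV[R[i]]_n.
Hypothesis b_gt0 : forall i, 0 < b i 0.
Hypothesis xs_sol : pr_solution A b xs.
Local Notation C := R[i].
Local Notation iC := (Complex 0 1 : C).
Local Notation zs := (z_nat A xs).
Implicit Types (x : 'cV[C]_n) (z u v : 'cV[C]_(n + m)).

Definition sample_phase j : C := phase ((A^t* *m xs) j 0).
Local Notation w := sample_phase.

Lemma measurement_phase j : (A^t* *m xs) j 0 = (b j 0)%:C%C * w j.
Proof. by rewrite -xs_sol -normc_phase_eq. Qed.

Lemma norm_measurement_phase j : `|w j| = 1.
Proof.
apply: norm_phase; apply: contraTneq (b_gt0 j) => h.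
by rewrite -xs_sol h Normc.normc0 ltxx.
Qed.

(** If every entry of [A^t* x] is orthogonal to the corresponding measurement,
    then moving [xs] slightly along [- i x] changes the moduli of the
    measurements but not their phases; hence [- i x] is a real multiple of
    [xs]. *)
Lemma graph_tangent_kernel x :
  (forall x', mr_solution A xs x' ->
     exists c : R, c != 0 /\ x' = c%:C%C *: xs) ->
  (forall j, complex.Re ((w j)^* * (A^t* *m x) j 0) = 0) ->
  exists r : R, x = r%:C%C *: (iC *: xs).
Proof.
move=> mr h.
pose r j := complex.Im ((w j)^* * (A^t* *m x) j 0).
have xE j : (A^t* *m x) j 0 = w j * (iC * (r j)%:C%C).
  have -> : iC * (r j)%:C%C = (w j)^* * (A^t* *m x) j 0.
    have := h j; rewrite /r; case: (_ * _) => a c /= ->; by simpc.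
  by rewrite mulrA [w j * _]mulrC unit_conjM ?mul1r// norm_measurement_phase.
(* A step [s] so small that all moduli [b j 0 + s * r j] stay positive. *)
pose S := \sum_j `|r j| / b j 0; pose s := (1 + S)^-1.
have S0 : 0 <= S by apply: sumr_ge0 => j _; rewrite divr_ge0 ?(ltW (b_gt0 j)).
have s0 : 0 < s by rewrite invr_gt0 ltr_pwDl.
have bs j : 0 < b j 0 + s * r j.
  suff : s * `|r j| < b j 0.
    have := ler_norm (- r j); rewrite normrN => h1 h2.
    have := ler_wpM2l (ltW s0) h1; lra.
  rewrite mulrC ltr_pdivrMr ?ltr_pwDl// -ltr_pdivrMl// mulrC.
  apply: (@le_lt_trans _ _ S); last by rewrite ltrDr.
  rewrite /S (bigD1 j)//= lerDl; apply: sumr_ge0 => k _.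
  by rewrite divr_ge0 ?(ltW (b_gt0 k)).
pose x' := - iC *: x.
have [c [c0 hc]] : exists c : R, c != 0 /\ xs + s%:C%C *: x' = c%:C%C *: xs.
  apply: mr => j; left.
  have -> : (A^t* *m (xs + s%:C%C *: x')) j 0 =
      (A^t* *m xs) j 0 + s%:C%C * (- iC * (A^t* *m x) j 0).
    rewrite mulmxDr -!scalemxAr.
    by move: (A^t* *m xs) (A^t* *m x) => y1 y2; rewrite !mxE.
  rewrite xE -/(w j) measurement_phase.
  have -> : (b j 0)%:C%C * w j + s%:C%C * (- iC * (w j * (iC * (r j)%:C%C))) =
      w j * (b j 0 + s * r j)%:C%C.
    have i2 : - iC * iC = 1 by simpc.
    move: iC i2 (w j) => i1 i12 wj.
    by rewrite rmorphD rmorphM /= [- i1 * _]mulrCA [- i1 * _]mulrA i12; ring.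
  by rewrite phaseM phase_unit ?norm_measurement_phase// phase_pos// mulr1.
exists ((c - 1) / s).
have sn0 : s%:C%C != 0 :> C by rewrite (inj_eq (@complexI R)) gt_eqF.
have hx : x = iC *: x' by rewrite scalerA mulrN -expr2; simpc; rewrite scale1r.
have hx' : x' = ((c - 1) / s)%:C%C *: xs.
  apply: (scalerI sn0); rewrite [RHS]scalerA -rmorphM /= mulrC divfK ?gt_eqF//.
  by rewrite rmorphB scalerBl -hc scale1r addrC addKr.
by rewrite hx hx' !scalerA mulrC.
Qed.

(** The complement of the differential of [prox_phi] at [z_nat A xs]: [prox_phi]
    is the identity on the [x] block, and on the [y] block it is insensitive,
    to first order, to changes along the phases. *)
Definition radial u : 'cV[C]_(n + m) :=
  col_mx 0 (\col_j radial_part (w j) (dsubmx u j 0)).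

Lemma radialD u v : radial (u + v) = radial u + radial v.
Proof.
rewrite /radial add_col_mx addr0; congr col_mx; apply/colP => j.
by rewrite !mxE /radial_part mulrDr linearD rmorphD mulrDl.
Qed.

Lemma radialZ (r : R) u : radial (r%:C%C *: u) = r%:C%C *: radial u.
Proof.
rewrite /radial scale_col_mx scaler0; congr col_mx; apply/colP => j.
have ReZ (a : C) : complex.Re (r%:C%C * a) = r * complex.Re a.
  by case: a => a c /=; rewrite mul0r subr0.
by rewrite !mxE /radial_part [_^* * (_ * _)]mulrCA ReZ rmorphM -mulrA.
Qed.

Lemma rdot_radial u : rdot (u - radial u) (radial u) = 0.
Proof.
rewrite -[X in X - _](vsubmxK u) /radial opp_col_mx add_col_mx rdot_col_mx.
rewrite rdot0r add0r /rdot big1// => j _.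
move: (dsubmx u) => y; rewrite !mxE; move: (y j 0) => h.
have w1 := norm_measurement_phase j.
have -> : radial_part (w j) h = w j * (complex.Re ((w j)^* * h))%:C%C.
  by rewrite /radial_part mulrC.
have hE : h = w j * ((w j)^* * h) by rewrite mulrA [w j * _]mulrC unit_conjM// mul1r.
rewrite [X in X - _]hE -mulrBr cdot_adj mulrA unit_conjM// mul1r.
by case: (_ * h) => a c; rewrite /cdot /=; ring.
Qed.

End Linearization.

(** * Contraction of the linearized iteration *)

Section Contraction.
Variables (R : realType) (n m : nat) (A : 'M[R[i]]_(n, m)) (b : 'cV[R]_m).
Variable xs : 'cV[R[i]]_n.
Hypothesis b_gt0 : forall i, 0 < b i 0.
Hypothesis xs_sol : pr_solution A b xs.
Local Notation C := R[i].
Local Notation iC := (Complex 0 1 : C).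
Local Notation zs := (z_nat A xs).
Local Notation w := (sample_phase A xs).
Local Notation radial := (radial A xs).
Implicit Types (x : 'cV[C]_n) (z u v : 'cV[C]_(n + m)).

(** Where the differential fails to contract, the perturbation is tangent to
    the orbit under global phases. *)
Lemma fixed_direction u :
  (forall x, mr_solution A xs x ->
     exists c : R, c != 0 /\ x = c%:C%C *: xs) ->
  u = graph_proj A u -> radial u = 0 -> rdot u (iC *: zs) = 0 -> u = 0.
Proof.
move=> mr ug ur uo; have [x xE] := graph_proj_in A u; rewrite -ug in xE.
have [r rE] : exists r : R, x = r%:C%C *: (iC *: xs).
  apply: (graph_tangent_kernel b_gt0 xs_sol mr) => j.
  have := congr1 (fun y : 'cV_(n + m) => y (rshift n j) 0) ur.
  rewrite /radial col_mxEd mxE [RHS]mxE /radial_part xE /z_nat col_mxKd => /eqP.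
  rewrite mulf_eq0 => /orP[|/eqP w0].
    by rewrite (inj_eq (@complexI R)) => /eqP.
  by have := norm_measurement_phase b_gt0 xs_sol j; rewrite w0 normr0 => /eqP;
    rewrite eq_sym oner_eq0.
apply: rdot_eq0; have uE : u = r%:C%C *: (iC *: zs) by rewrite xE rE !z_natZ.
by rewrite {2}uE rdotZr uo mulr0.
Qed.

(** The two defects in [DR_lin_sqr] control [u - Pi u] and [radial u], and these
    two, together with the component along [i zs], determine [u]; so they are
    bounded below by a multiple of [norm2 u]. *)
Lemma DR_lin_contraction (t : R) : 0 < t < 1 ->
  (forall x, mr_solution A xs x ->
     exists c : R, c != 0 /\ x = c%:C%C *: xs) ->
  exists g : R, [/\ 0 < g, g < 1 & forall v, rdot v (iC *: zs) = 0 ->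
    norm2 (DR_lin A t (v - radial v) (radial v)) <= g * norm2 v].
Proof.
move=> /andP[t0 t1] mr.
(* The last entry is the component of [u] along the orbit, which vanishes for
   the perturbations considered. *)
pose f u : 'cV[C]_(n + m + (n + m + 1)) := col_mx (u - graph_proj A u)
  (col_mx (radial u) (const_mx (rdot u (iC *: zs))%:C%C)).
have [||| c c0 hc] := @injective_bounded_below R _ _ f.
- move=> u v; rewrite /f graph_projD radialD rdotDl !add_col_mx opprD addrACA.
  by congr (col_mx _ (col_mx _ _)); apply/colP => i; rewrite !mxE rmorphD.
- move=> r u; rewrite /f graph_projZ radialZ rdotZl !scale_col_mx scalerBr.
  by congr (col_mx _ (col_mx _ _)); apply/colP => i; rewrite !mxE rmorphM.
- move=> u fu.
  have := congr1 usubmx fu; rewrite /f col_mxKu linear0 => h1.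
  have := congr1 dsubmx fu; rewrite /f col_mxKd linear0 => h23.
  have := congr1 usubmx h23; rewrite col_mxKu linear0 => h2.
  have := congr1 dsubmx h23; rewrite col_mxKd linear0 => h3.
  apply: fixed_direction => //; first by apply/eqP; rewrite -subr_eq0 h1.
  by have := congr1 (fun y : 'cV_1 => y 0 0) h3; rewrite !mxE => /complexI.
pose s := Num.min (1 - t) t * c / 3.
have s0 : 0 < s by rewrite divr_gt0// mulr_gt0// lt_min subr_gt0 t1.
(* The maximum makes the rate positive without an upper bound on [c]. *)
pose g2 := Num.max (1 - s) (1 / 4).
have g2_gt0 : 0 < g2 by rewrite lt_max divr_gt0 ?orbT.
exists (Num.sqrt g2); split; first by rewrite sqrtr_gt0.
  rewrite -sqrtr1 ltr_sqrt// gt_max; apply/andP; split; lra.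
move=> v vo; rewrite norm2_leM ?sqrtr_ge0// sqr_sqrtr ?(ltW g2_gt0)//.
have tt : 0 <= t <= 1 by rewrite !ltW.
apply: le_trans (DR_lin_sqr A tt (rdot_radial b_gt0 xs_sol v)) _; rewrite subrK.
have := hc v; rewrite /f rdot_col_mx (rdot_col_mx (radial v)) vo.
have -> : rdot (const_mx 0%:C%C : 'cV[C]_1) (const_mx 0%:C%C) = 0.
  by rewrite /rdot big1// => i _; rewrite mxE cdot0r.
rewrite addr0.
set q := radial v; set p := v - q.
have -> : v - graph_proj A v = (p - graph_proj A p) + (q - graph_proj A q).
  by rewrite addrACA -opprD -graph_projD subrK.
have := rdot_graph_proj A q; have := rdot_ge0 (graph_proj A q).
move: (p - graph_proj A p) (q - graph_proj A q) => p' q'.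
move: (rdot (graph_proj A q) _) => gq.
have := rdot_ge0 (p' - q'); have := rdot_ge0 p'; have := rdot_ge0 q.
rewrite !(rdotDr, rdotDl, rdotNr, rdotNl) (rdotC q' p').
move: (rdot q q) (rdot p' p') (rdot q' q') (rdot p' q') => Q P' Q' D.
move=> Q0 P0 hD gq0 hq hv.
have V0 := rdot_ge0 v; move: (rdot v v) hv V0 => V hv V0.
have h3 : c * V <= 3 * (P' + Q) by lra.
set mn := Num.min (1 - t) t.
have mn1 : mn <= 1 - t by rewrite ge_min lexx.
have mn2 : mn <= t by rewrite ge_min lexx orbT.
have mn0 : 0 <= mn by rewrite le_min subr_ge0 !ltW.
have h4 : mn * (P' + Q) <= (1 - t) * P' + t * Q.
  by rewrite mulrDr lerD// ler_wpM2r.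
have h5 : s * V <= mn * (P' + Q).
  have -> : s * V = mn * ((c * V) / 3) by rewrite /s -/mn; ring.
  by apply: ler_wpM2l => //; lra.
have h6 : (1 - s) * V <= g2 * V by rewrite ler_wpM2r// le_max lexx.
lra.
Qed.

End Contraction.

(** * One step of the nonlinear iteration *)

Section Step.
Variables (R : realType) (n m : nat) (A : 'M[R[i]]_(n, m)) (b : 'cV[R]_m).
Variable xs : 'cV[R[i]]_n.
Hypothesis b_gt0 : forall i, 0 < b i 0.
Hypothesis xs_sol : pr_solution A b xs.
Local Notation C := R[i].
Local Notation normc := (@Normc.normc R).
Local Notation iC := (Complex 0 1 : C).
Local Notation zs := (z_nat A xs).
Local Notation w := (sample_phase A xs).
Local Notation radial := (radial A xs).
Implicit Types (x : 'cV[C]_n) (z u v : 'cV[C]_(n + m)).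

(** The remainder of the first-order expansion of [prox_phi] at [zs]. *)
Definition prox_error v : 'cV[C]_(n + m) :=
  prox_phi b (zs + v) - zs - (v - radial v).

Lemma prox_error_x v i : prox_error v (lshift m i) 0 = 0.
Proof.
rewrite /prox_error /prox_phi /radial /z_nat; move: (A^t* *m xs) => y.
rewrite -[v]vsubmxK add_col_mx !opp_col_mx !add_col_mx !opp_col_mx !add_col_mx.
by rewrite col_mxEu col_mxKu !mxE; ring.
Qed.

Lemma prox_error_y v j : let h := v (rshift n j) 0 in
  prox_error v (rshift n j) 0 =
  (b j 0)%:C%C * phase ((b j 0)%:C%C * w j + h) - (b j 0)%:C%C * w j -
  (h - radial_part (w j) h).
Proof.
rewrite /= -(measurement_phase xs_sol).
rewrite /prox_error /prox_phi /radial /z_nat; move: (A^t* *m xs) => y.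
rewrite -[v]vsubmxK add_col_mx !opp_col_mx !add_col_mx !opp_col_mx !add_col_mx.
by rewrite !col_mxEd !col_mxKd !mxE.
Qed.

Lemma prox_error_le v : norm2 (prox_error v) <= 2 * norm2 v /\
  norm2 (prox_error v) <= (\sum_j 4 / b j 0) * norm2 v * norm2 v.
Proof.
have S0 : 0 <= \sum_j 4 / b j 0 by apply: sumr_ge0 => j _; rewrite divr_ge0 ?ltW.
have ec i : normc (prox_error v i 0) <= 2 * normc (v i 0) /\
    normc (prox_error v i 0) <=
      (\sum_j 4 / b j 0) * norm2 v * normc (v i 0).
  case: (split_ordP i) => j ->.
    by rewrite prox_error_x Normc.normc0 !mulr_ge0 ?normc_ge0 ?norm2_ge0.
  rewrite prox_error_y; have w1 := norm_measurement_phase b_gt0 xs_sol j.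
  have [h1 h2] := phase_taylor (v (rshift n j) 0) (b_gt0 j) w1; split => //.
  apply: (le_trans h2); rewrite ler_wpM2r ?normc_ge0//.
  apply: ler_pM; rewrite ?normc_ge0 ?coord_le_norm2//.
    by rewrite divr_ge0 ?ltW.
  by rewrite (bigD1 j)//= lerDl sumr_ge0// => k _; rewrite divr_ge0 ?ltW.
by split; apply: norm2_le_coord => [|i]; rewrite ?mulr_ge0 ?norm2_ge0//;
  case: (ec i).
Qed.

(** The contribution of the error [e] of [prox_phi] to one step; it equals
    [Pi e + (2 t - 1) (e - Pi e)], whence its norm is at most that of [e]. *)
Definition reflect_error (t : R) e : 'cV[C]_(n + m) :=
  graph_proj A e + ((2 * t - 1)%:C%C *: e - graph_proj A ((2 * t - 1)%:C%C *: e)).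

Lemma reflect_error_le (t : R) e : 0 <= t <= 1 ->
  norm2 (reflect_error t e) <= norm2 e.
Proof.
move=> /andP[t0 t1]; rewrite norm2_le graph_proj_pyth graph_projZ -scalerBr.
rewrite rdotZl rdotZr mulrA -expr2 [leRHS](rdot_graph_proj A e) lerD2l.
rewrite ler_piMl ?rdot_ge0//; nra.
Qed.

(** An exact identity, because the Douglas-Rachford map is affine in the value
    of [prox_phi]. *)
Lemma DR_map_expansion (t : R) v :
  DR_map A b t (zs + v) - zs =
  DR_lin A t (v - radial v) (radial v) + reflect_error t (prox_error v).
Proof.
have hp : prox_phi b (zs + v) = zs + (v - radial v) + prox_error v.
  rewrite /prox_error; move: (prox_phi _ _) (v - _) => x y.
  by rewrite -addrA subrKC subrKC.
rewrite /DR_map /relaxed_proj hp; move: (radial v) (prox_error v) => q e.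
have {hp} -> : 2 *: (zs + (v - q) + e) - (zs + v) = zs + ((v - q) - q + e + e).
  by apply/colP => i; rewrite !mxE; ring.
rewrite /DR_lin /reflect_error !graph_projD !graph_projN !graph_projZ.
rewrite graph_proj_id; move: zs => z.
move: (graph_proj A v) (graph_proj A q) (graph_proj A e) => v' q' e'.
by apply/colP => i; rewrite !mxE !rmorphB rmorphM /= rmorph1 rmorph_nat; ring.
Qed.

(** The second bound grows only linearly; it is what makes starting points far
    from the orbit harmless. *)
Lemma DR_step (t : R) : 0 < t < 1 ->
  (forall x, mr_solution A xs x ->
     exists c : R, c != 0 /\ x = c%:C%C *: xs) ->
  exists (g K : R), [/\ 0 < g, g < 1, 0 <= K &
    forall v, rdot v (iC *: zs) = 0 ->
    norm2 (DR_map A b t (zs + v) - zs) <= (g + K * norm2 v) * norm2 v /\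
    norm2 (DR_map A b t (zs + v) - zs) <= (g + 2) * norm2 v].
Proof.
move=> t01 mr; have [g [g0 g1 hg]] := DR_lin_contraction b_gt0 xs_sol t01 mr.
exists g, (\sum_j 4 / b j 0); split => //.
  by apply: sumr_ge0 => j _; rewrite divr_ge0 ?ltW.
move=> v vo; have [h1 h2] := prox_error_le v; rewrite DR_map_expansion.
have tt : 0 <= t <= 1 by case/andP: t01 => *; rewrite !ltW.
have h3 := reflect_error_le (prox_error v) tt; have h4 := hg v vo.
by split; apply: le_trans (norm2_triangle _ _) _; rewrite mulrDl lerD//;
  apply: le_trans h3 _.
Qed.

End Step.

(** * Distance up to a global phase, and the RGPS dynamics *)

Section Distance.
Variables (R : realType) (p : nat).
Local Notation C := R[i].
Local Notation iC := (Complex 0 1 : C).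
Local Notation normc := (@Normc.normc R).
Implicit Types u v : 'cV[C]_p.

Lemma dist_le u v (a : C) : `|a| = 1 -> dist u v <= norm2 (u - a *: v).
Proof.
move=> a1; apply: ge_inf; last by exists a.
by exists 0 => _ [c _ <-]; exact: norm2_ge0.
Qed.

Lemma dist_nearest u v (a : C) : nearest_phase u v a ->
  dist u v = norm2 (u - a *: v).
Proof.
move=> [a1 hmin]; apply/eqP; rewrite eq_le dist_le//=.
apply: lb_le_inf; first by exists (norm2 (u - a *: v)), a.
by move=> _ [c c1 <-]; exact: hmin.
Qed.

Lemma dist_ge0 u v : 0 <= dist u v.
Proof.
apply: lb_le_inf; first by exists (norm2 (u - 1 *: v)), 1 => //; exact: normr1.
by move=> _ [c _ <-]; exact: norm2_ge0.
Qed.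

Lemma rdot_unit (a : C) v : `|a| = 1 -> rdot (a *: v) (a *: v) = rdot v v.
Proof. by move=> a1; rewrite rdot_unit_adj scalerA unit_conjM// scale1r. Qed.

(** The squared distance to [a *: v] depends on [a] only through the real part
    of [a^* * s], with [s] the Hermitian product of [v] and [u]; it is least
    when [a] is the phase of [s], and then [a^* * s] is real, which is the
    orthogonality to the tangent of the orbit. *)
Lemma exists_nearest_phase u v : exists a : C,
  nearest_phase u v a /\ rdot (u - a *: v) (a *: (iC *: v)) = 0.
Proof.
pose s := \sum_i (v i 0)^* * u i 0.
have sE (a : C) : rdot u (a *: v) = complex.Re (a^* * s).
  rewrite /s mulr_sumr raddf_sum; apply: eq_bigr => i _; rewrite mxE.
  by case: a (u i 0) (v i 0) => [? ?] [? ?] [? ?]; rewrite /cdot /=; ring.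
(* If [s = 0], all points of the orbit are equally near. *)
pose a : C := if s == 0 then 1 else phase s.
have a1 : `|a| = 1 by rewrite /a; case: eqP => [_|/eqP/norm_phase//]; rewrite normr1.
have as_ : a^* * s = (normc s)%:C%C.
  rewrite /a; case: eqP => [->|/eqP s0]; first by rewrite mulr0 Normc.normc0.
  by rewrite {2}[s]normc_phase_eq mulrCA unit_conjM ?mulr1// norm_phase.
have expand c : `|c| = 1 -> rdot (u - c *: v) (u - c *: v) =
    rdot u u - 2 * complex.Re (c^* * s) + rdot v v.
  move=> c1; rewrite rdotDr !rdotDl !rdotNl !rdotNr rdot_unit//.
  by rewrite (rdotC (c *: v)) sE; ring.
exists a; split; first split => // c c1.
  rewrite norm2_le !expand// as_ lerD2r lerD2l lerN2 ler_pM2l//=.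
  apply: le_trans (ler_norm _) _; rewrite -lecR; apply: le_trans (normc_ge_Re _) _.
  by rewrite normrM norm_conjC c1 mul1r normcE.
have vi : rdot v (iC *: v) = 0.
  by rewrite /rdot big1// => i _; rewrite mxE; case: (v i 0) => ? ?;
    rewrite /cdot /=; ring.
rewrite rdotDl rdotNl rdot_unit_adj [_^* *: _]scalerA unit_conjM// scale1r.
rewrite vi subr0 scalerA sE rmorphM /= mulrAC as_.
by simpc; rewrite /=; ring.
Qed.

End Distance.

Section Dynamics.
Variables (R : realType) (n m : nat) (A : 'M[R[i]]_(n, m)) (b : 'cV[R]_m).
Local Notation C := R[i].
Implicit Types (z : 'cV[C]_(n + m)) (s : rgps_state R n m).

Lemma prox_phiZ (a : C) z : `|a| = 1 -> prox_phi b (a *: z) = a *: prox_phi b z.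
Proof.
move=> a1; rewrite /prox_phi scale_col_mx; congr col_mx.
  by apply/colP => i; rewrite !mxE.
by apply/colP => i; rewrite !mxE phaseM phase_unit// mulrCA.
Qed.

Lemma DR_mapZ (t : R) (a : C) z : `|a| = 1 ->
  DR_map A b t (a *: z) = a *: DR_map A b t z.
Proof.
move=> a1; rewrite /DR_map /relaxed_proj prox_phiZ//.
have -> : 2 *: (a *: prox_phi b z) - a *: z = a *: (2 *: prox_phi b z - z).
  by rewrite scalerBr scalerA mulrC -scalerA.
rewrite graph_projZ; move: (graph_proj A (2 *: prox_phi b z - z)) (prox_phi b z) => y1 y2.
by apply/colP => i; rewrite !mxE; ring.
Qed.

(** After one step the multiplier [lambda] vanishes, because the regularizer of
    [x] is zero, and [y] is the proximal point of the [y] block of [z_DR].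
    Then [z_DR] determines the whole state. *)
Definition after_step s : Prop :=
  rgps_lambda s = 0 /\ rgps_y s = prox_f b (rgps_nu s + rgps_y s).

Lemma rgps_step_after (t : R) s : after_step (rgps_step A b t s).
Proof.
case: s => x y la nu; rewrite /after_step /rgps_step /=; split.
  by rewrite [usubmx _ + la]addrC subrr.
by rewrite subrK addrC.
Qed.

Lemma z_DR_step (t : R) s : after_step s ->
  z_DR (rgps_step A b t s) = DR_map A b t (z_DR s).
Proof.
case: s => x y la nu [/= -> hy].
rewrite /z_DR /DR_map /rgps_step /= /prox_phi col_mxKu col_mxKd -hy.
have -> : 2 *: col_mx (0 + x) y - col_mx (0 + x) (nu + y) = col_mx (x - 0) (y - nu).
  rewrite scale_col_mx opp_col_mx add_col_mx; congr col_mx;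
  by apply/colP => i; rewrite !mxE; ring.
move: (relaxed_proj _ _ _) => h; rewrite -[in RHS](vsubmxK h).
rewrite opp_col_mx !add_col_mx; congr col_mx;
  by apply/colP => i; rewrite !mxE; ring.
Qed.

Lemma rgps_after (t : R) s k : after_step (rgps A b t s k.+1).
Proof. by rewrite /rgps iterS; exact: rgps_step_after. Qed.

Lemma z_DR_rgps (t : R) s k :
  z_DR (rgps A b t s k.+2) = DR_map A b t (z_DR (rgps A b t s k.+1)).
Proof. by rewrite {1}/rgps iterS z_DR_step//; exact: rgps_after. Qed.

End Dynamics.

(** * Singular values and the bound on the relaxation parameter *)

Section SingularValues.
Variable R : realType.
Local Notation C := R[i].

Lemma norm2_cols p q (M : 'M[C]_(p, q)) j :
  (M^t* *m M) j j = (rdot (col j M) (col j M))%:C%C.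
Proof.
rewrite mxE /rdot rmorph_sum; apply: eq_bigr => i _; rewrite !mxE.
by case: (M i j) => a c; simpc; rewrite /cdot /=; congr Complex; ring.
Qed.

Lemma gram_normal p q (M : 'M[C]_(p, q)) : M^t* *m M \is normalmx.
Proof.
apply: hermitian_normalmx; apply/is_hermitianmxP.
rewrite expr0 scale1r trmx_mul map_mxM; congr (_ *m _).
by rewrite map_trmx trmxK -map_mx_comp map_mx_id// => z; exact: conjCK.
Qed.

(** Each eigenvalue of [M^t* *m M] is the squared norm of the image under [M] of
    a unit eigenvector. *)
Lemma spectral_diag_gram_le1 p q (M : 'M[C]_(p, q)) j :
  (forall v, norm2 (M *m v) <= norm2 v) ->
  complex.Re (spectral_diag (M^t* *m M) 0 j) <= 1.
Proof.
move=> hM; set G := M^t* *m M; set P := spectralmx G.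
have PP : P *m P^t* = 1%:M by apply/unitarymxP; exact: spectral_unitarymx.
have PE : diag_mx (spectral_diag G) = P *m G *m P^t*.
  have /orthomx_spectralP GE := gram_normal M.
  rewrite -/G -/P in GE; rewrite {2}GE !mulmxA mulmxV ?spectral_unit// mul1mx.
  by rewrite -mulmxA PP mulmx1.
have PtE : (P^t*)^t* = P.
  by rewrite map_trmx trmxK -map_mx_comp map_mx_id// => z; exact: conjCK.
have -> : spectral_diag G 0 j = ((M *m P^t*)^t* *m (M *m P^t*)) j j.
  rewrite trmx_mul map_mxM PtE mulmxA -[_ *m M^t* *m M]mulmxA -/G -PE.
  by rewrite mxE eqxx mulr1n.
rewrite norm2_cols /= -norm2_sqr.
have -> : col j (M *m P^t*) = M *m col j (P^t*) by rewrite !colE mulmxA.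
have Pj : norm2 (col j (P^t*)) ^+ 2 = 1.
  by rewrite norm2_sqr; apply: (@complexI R); rewrite -norm2_cols PtE PP mxE eqxx.
by rewrite -Pj ler_pXn2r ?nnegrE ?norm2_ge0.
Qed.

Lemma singular_values_le1 p q (M : 'M[C]_(p, q)) :
  (forall v, norm2 (M *m v) <= norm2 v) ->
  forall i, 0 <= (singular_values M)`_i <= 1.
Proof.
move=> hM i; have [hi|hi] := ltnP i (size (singular_values M)); last first.
  by rewrite nth_default// lexx ler01.
have := mem_nth 0 hi; rewrite mem_sort => /mapP[j _ ->].
rewrite sqrtr_ge0 /= -[leRHS]sqrtr1 ler_wsqrtr//.
exact: spectral_diag_gram_le1.
Qed.

(** The stacked matrix maps a real vector to the real and imaginary parts of its
    image under [B]; the real and imaginary parts of a complex argument are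
    treated separately. *)
Lemma re_im_nonexpansive p q (B : 'M[C]_(p, q)) :
  (forall v, norm2 (B *m v) <= norm2 v) ->
  forall v, norm2 (map_mx (real_complex R) (re_im_mx B) *m v) <= norm2 v.
Proof.
move=> hB v; rewrite norm2_le.
pose v1 : 'cV[C]_q := \col_j (complex.Re (v j 0))%:C%C.
pose v2 : 'cV[C]_q := \col_j (complex.Im (v j 0))%:C%C.
have -> : rdot v v = rdot v1 v1 + rdot v2 v2.
  rewrite /rdot -big_split; apply: eq_bigr => i _; rewrite !mxE /cdot /=.
  by rewrite mulr0 !addr0.
have vE j : v j 0 = Complex (complex.Re (v j 0)) (complex.Im (v j 0)).
  by case: (v j 0).
rewrite /re_im_mx map_col_mx mul_col_mx rdot_col_mx.
apply: (@le_trans _ _ (rdot (B *m v1) (B *m v1) + rdot (B *m v2) (B *m v2))); last first.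
  by rewrite lerD// -norm2_le.
rewrite le_eqVlt; apply/orP; left; apply/eqP.
rewrite /rdot -!big_split; apply: eq_bigr => i _ /=.
have S1 (f : 'M[R]_(p, q)) (g : 'cV[C]_q) :
   complex.Re ((map_mx (real_complex R) f *m g) i 0) =
   \sum_j f i j * complex.Re (g j 0).
  rewrite mxE raddf_sum; apply: eq_bigr => j _; rewrite mxE.
  by case: (g j 0) => a c /=; rewrite mul0r subr0.
have S2 (f : 'M[R]_(p, q)) (g : 'cV[C]_q) :
   complex.Im ((map_mx (real_complex R) f *m g) i 0) =
   \sum_j f i j * complex.Im (g j 0).
  rewrite mxE raddf_sum; apply: eq_bigr => j _; rewrite mxE.
  by case: (g j 0) => a c /=; rewrite mul0r addr0.
have S3 (h : 'I_q -> R) : complex.Re ((B *m \col_j (h j)%:C%C) i 0) =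
   \sum_j map_mx (@complex.Re R) B i j * h j.
  rewrite mxE raddf_sum; apply: eq_bigr => j _; rewrite !mxE.
  by case: (B i j) => a c /=; rewrite mulr0 subr0.
have S4 (h : 'I_q -> R) : complex.Im ((B *m \col_j (h j)%:C%C) i 0) =
   \sum_j map_mx (@complex.Im R) B i j * h j.
  rewrite mxE raddf_sum; apply: eq_bigr => j _; rewrite !mxE.
  by case: (B i j) => a c /=; rewrite mulr0 add0r.
by rewrite /cdot !S1 !S2 !S3 !S4; ring.
Qed.

End SingularValues.

Section Threshold.
Variables (R : realType) (n m : nat) (A : 'M[R[i]]_(n, m)).
Local Notation C := R[i].
Local Notation normc := (@Normc.normc R).

Lemma cholesky_coisometry (L : 'M[C]_n) :
  is_cholesky L (1%:M + A *m A^t*) ->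
  let K := row_mx (invmx L) (invmx L *m A) in K *m K^t* = 1%:M.
Proof.
move=> [trigL Lpos LE] /=.
have Lu : L \in unitmx.
  rewrite unitmxE det_trig// unitfE; apply/prodf_neq0 => i _.
  by rewrite gt_eqF.
have KE : row_mx (invmx L) (invmx L *m A) = invmx L *m row_mx 1%:M A.
  by rewrite mul_mx_row mulmx1.
have GE : row_mx 1%:M A *m (row_mx 1%:M A)^t* = L *m L^t*.
  by rewrite -LE tr_row_mx map_col_mx mul_row_col trmx1 map_mx1 mulmx1.
rewrite KE trmx_mul map_mxM mulmxA -(mulmxA (invmx L)) GE mulmxA mulVmx// mul1mx.
by rewrite -map_mxM -trmx_mul mulVmx// trmx1 map_mx1.
Qed.

(** [K^t* *m K] is an orthogonal projection: expand the squared norm of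
    [v - K^t* K v]. *)
Lemma coisometry_nonexpansive p q (K : 'M[C]_(p, q)) v :
  K *m K^t* = 1%:M -> norm2 (K *m v) <= norm2 v.
Proof.
move=> KK; have := rdot_ge0 (v - K^t* *m (K *m v)).
have adj u y : rdot u (K^t* *m y) = rdot (K *m u) y by rewrite rdot_mulmx.
rewrite norm2_le rdotDr !rdotDl !rdotNr !rdotNl (rdotC (K^t* *m _) v) !adj.
by rewrite !(mulmxA K (K^t*)) KK mul1mx => h; lra.
Qed.

(** Entries of [Omega] have modulus 1 or 0, and the remaining factor is a
    coisometry. *)
Lemma B_mx_nonexpansive (L : 'M[C]_n) (xs : 'cV[C]_n) v :
  is_cholesky L (1%:M + A *m A^t*) -> norm2 (B_mx A L xs 1 *m v) <= norm2 v.
Proof.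
move=> hL; rewrite /B_mx -mulmxA.
apply: le_trans (coisometry_nonexpansive _ (cholesky_coisometry hL)) _.
rewrite -[leRHS]mul1r; apply: norm2_le_coord => // i.
rewrite /Omega mul_diag_mx [in X in normc X]mxE [X in X * v i 0]mxE mul1r.
rewrite normcM ler_wpM2r ?normc_ge0//.
have [->|z0] := eqVneq (z_nat A xs i 0) 0; first by rewrite mul0r Normc.normc0.
by rewrite -lecR -normcE norm_phase.
Qed.

Lemma t_max_lt1 (L : 'M[C]_n) (xs : 'cV[C]_n) :
  is_cholesky L (1%:M + A *m A^t*) -> t_max A L xs < 1.
Proof.
move=> hL; rewrite /t_max /beta_tilde.
set s := sigma2 A L xs.
have /andP[s0 s1] : 0 <= s <= 1.
  apply: singular_values_le1; apply: re_im_nonexpansive => v.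
  exact: B_mx_nonexpansive.
set d := delta1 A.
have d0 : 0 < d ^+ 2.
  by rewrite exprn_gt0// divr_gt0// sqrtr_gt0 ltr_pwDl ?sqr_ge0.
have d1 : d ^+ 2 <= 1.
  rewrite expr_le1// ?divr_ge0 ?sqrtr_ge0//.
  rewrite /d /delta1 ler_pdivrMr ?sqrtr_gt0 ?ltr_pwDl ?sqr_ge0// mul1r.
  by rewrite -[leLHS]sqrtr1 ler_wsqrtr// lerDl sqr_ge0.
have s2 : s ^+ 2 <= 1 by rewrite expr_le1.
move: (s ^+ 2) (sqr_ge0 s) s2 (d ^+ 2) d0 d1 => S S0 S1 D D0 D1.
set M := Num.max _ _.
have M1 : M <= 1 by rewrite ge_max S1 andbT; nra.
have M0 : 0 < M by rewrite lt_max; apply/orP; left; nra.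
by rewrite sqr_sqrtr ?ltW// ltr_pdivrMr; lra.
Qed.

End Threshold.

(** * Local linear convergence *)

Section LocalConvergence.
Variables (R : realType) (n m : nat) (A : 'M[R[i]]_(n, m)) (b : 'cV[R]_m).
Variable xs : 'cV[R[i]]_n.
Local Notation C := R[i].
Local Notation normc := (@Normc.normc R).
Local Notation iC := (Complex 0 1 : C).
Local Notation zs := (z_nat A xs).
Implicit Types (z : 'cV[C]_(n + m)) (s : rgps_state R n m).

(** By equivariance under global phases, one may rotate so that [zs] itself is
    the nearest point of the orbit; the perturbation is then orthogonal to
    [i zs]. *)
Lemma dist_DR_map (t : R) (f : R -> R) :
  (forall v, rdot v (iC *: zs) = 0 ->
     norm2 (DR_map A b t (zs + v) - zs) <= f (norm2 v)) ->
  forall z, dist (DR_map A b t z) zs <= f (dist z zs).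
Proof.
move=> hf z; have [a [an ao]] := exists_nearest_phase z zs.
have a1 := an.1; rewrite (dist_nearest an).
pose v := a^* *: (z - a *: zs).
have vE : norm2 (z - a *: zs) = norm2 v by rewrite norm2_unit ?norm_conj1.
have zE : z = a *: (zs + v).
  by rewrite scalerDr scalerA [a * _]mulrC unit_conjM// scale1r addrC subrK.
rewrite vE; apply: le_trans (dist_le _ _ a1) _.
rewrite [z in DR_map _ _ _ z]zE DR_mapZ// -scalerBr norm2_unit//; apply: hf.
by rewrite rdot_unit_adj conjCK.
Qed.

Lemma dist_rgps_x s : rgps_lambda s = 0 ->
  dist (rgps_x s) xs <= dist (z_DR s) zs.
Proof.
move=> l0; have [a [an _]] := exists_nearest_phase (z_DR s) zs.
rewrite (dist_nearest an); apply: le_trans (dist_le _ _ an.1) _.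
rewrite norm2_le /z_DR l0 add0r /z_nat scale_col_mx opp_col_mx add_col_mx.
by rewrite rdot_col_mx lerDl rdot_ge0.
Qed.

Lemma dist_v_tilde z (a : C) : nearest_phase z zs a ->
  (forall i, zs i 0 != 0) -> dist z zs = norm2 (v_tilde A xs a z).
Proof.
move=> an z0; rewrite (dist_nearest an) /norm2; congr Num.sqrt.
apply: eq_bigr => i _; congr (_ ^+ 2).
have -> : v_tilde A xs a z i 0 =
    (a * zs i 0)^* / `|zs i 0| * (z - a *: zs) i 0.
  by rewrite /v_tilde; move: zs => zs'; rewrite !mxE.
rewrite normcM.
have -> : normc ((a * zs i 0)^* / `|zs i 0|) = 1.
  apply/normc_eq1; rewrite normrM norm_conjC normrM an.1 mul1r normfV normr_id.
  by rewrite divff ?normr_eq0.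
by rewrite mul1r.
Qed.

End LocalConvergence.

(** While [g + K * d 0 <= 1] the sequence does not increase, so the rate at the
    first step is valid for all; otherwise [eps] may be the constant 2, since
    such starting values stay away from 0. *)
Lemma geometric_decay (R : realType) (g K : R) : 0 < g -> g < 1 -> 0 <= K ->
  exists eps : R -> R, (eps s @[s --> 0^'+] --> (0 : R)) /\
    forall d : nat -> R, (forall k, 0 <= d k) ->
      (forall k, d k.+1 <= (g + K * d k) * d k) ->
      (forall k, d k.+1 <= (g + 2) * d k) ->
      forall k, d k <= (g + eps (d 0)) ^+ k * d 0.
Proof.
move=> g0 g1 K0.
pose eps (s : R) := if g + K * s <= 1 then K * s else 2.
exists eps; split.
  apply/cvgrPdist_lt => e e0; have K1 : 0 < K + 1 by lra.
  near=> s; have s0 : 0 < s by [].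
  have h1 : s * (K + 1) < 1 - g.
    rewrite -ltr_pdivlMr//; near: s; apply: nbhs_right_lt.
    by rewrite divr_gt0 ?subr_gt0.
  have h2 : s * (K + 1) < e.
    by rewrite -ltr_pdivlMr//; near: s; apply: nbhs_right_lt; rewrite divr_gt0.
  rewrite /eps ifT; last by nra.
  rewrite sub0r normrN ger0_norm ?mulr_ge0 ?(ltW s0)//; nra.
move=> d d0 h1 h2; rewrite /eps; case: ifP => gK; last first.
  elim=> [|k IH]; first by rewrite expr0 mul1r.
  apply: le_trans (h2 k) _; rewrite exprS -mulrA ler_wpM2l//; lra.
set q := g + K * d 0 in gK *.
have q0 : 0 <= q by rewrite addr_ge0 ?mulr_ge0// ltW.
elim=> [|k IH]; first by rewrite expr0 mul1r.
have dk : d k <= d 0.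
  by apply: (le_trans IH); rewrite ler_piMl// exprn_ile1.
apply: le_trans (h1 k) _; rewrite exprS -mulrA ler_pM//.
  by rewrite addr_ge0 ?mulr_ge0// ltW.
by rewrite lerD2l ler_wpM2l.
Unshelve. all: by end_near. Qed.

Theorem theorem3p8 (R : realType) (n m : nat) (n_gt0 : (0 < n)%N)
    (n_le_m : (n <= m)%N) (A : 'M[R[i]]_(n, m)) (b : 'cV[R]_m)
    (b_gt0 : forall i, 0 < b i 0) (xs : 'cV[R[i]]_n)
    (xs_sol : pr_solution A b xs) (hA : assumption1 A b xs)
    (L : 'M[R[i]]_n) (hL : is_cholesky L (1%:M + A *m A^t*))
    (t : R) (t_gt0 : 0 < t) (t_lt : t < t_max A L xs) :
  t_max A L xs < 1 /\
  forall rho : R, 0 < rho -> only_fixed_point_set A b t xs rho ->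
  exists (gamma : R) (eps : R -> R),
    [/\ 0 < gamma, gamma < 1, eps s @[s --> 0^'+] --> (0 : R) &
    forall s0 : rgps_state R n m,
      let z1 := z_DR (rgps A b t s0 1) in
      let d := dist z1 (z_nat A xs) in
      d < rho ->
      (forall alpha, nearest_phase z1 (z_nat A xs) alpha ->
         (forall j, xs j 0 != 0) -> d = norm2 (v_tilde A xs alpha z1)) /\
      (forall k : nat, (1 <= k)%N ->
         dist (rgps_x (rgps A b t s0 k)) xs <= (gamma + eps d) ^+ k.-1 * d)].
Proof.
have t_max1 := t_max_lt1 xs hL; split=> // rho _ _.
have mr x : mr_solution A xs x -> exists c : R, c != 0 /\ x = c%:C%C *: xs.
  by move/(mr_unique hA).
have t01 : 0 < t < 1 by rewrite t_gt0 (lt_trans t_lt).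
have [g [K [g0 g1 K0 step]]] := DR_step b_gt0 xs_sol t01 mr.
have [eps [eps0 decay]] := geometric_decay g0 g1 K0.
exists g, eps; split=> // s0 z1 d _; split.
  move=> alpha an xs0; apply: dist_v_tilde => // i.
  case: (split_ordP i) => j ->; first by rewrite col_mxEu.
  rewrite col_mxEd; apply: contraTneq (b_gt0 j) => h.
  by rewrite -xs_sol h Normc.normc0 ltxx.
case=> // k _; rewrite /=.
have [l0 _] := rgps_after A b t s0 k.
apply: le_trans (dist_rgps_x A xs l0) _.
pose dk k := dist (z_DR (rgps A b t s0 k.+1)) (z_nat A xs).
apply: (decay dk) => [j|j|j]; first exact: dist_ge0.
- rewrite /dk z_DR_rgps.
  by apply: (@dist_DR_map _ _ _ _ _ _ t (fun d => (g + K * d) * d)) => v /step[].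
- rewrite /dk z_DR_rgps.
  by apply: (@dist_DR_map _ _ _ _ _ _ t (fun d => (g + 2) * d)) => v /step[].
Qed.
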